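(* Let $m\ge 2$ be even, $n \ge 1$, let $\mathcal{A}$ be a symmetric real-valued $m$th-order $n$-dimensional tensor and let $\mathcal{B}$ be a symmetric positive definite real-valued $m$th-order $n$-dimensional tensor. Let $\lambda\in\mathbb{R}$ and $x\in\mathbb{R}^n\setminus\{0\}$. Then $(\lambda,x)$ satisfies $$\mathcal{A}x^{m-1}=\lambda\,\mathcal{B}x^{m-1}$$ if and only if the normalized vector $x/\|x\|$ is a KKT point, with Lagrange multiplier $\lambda$, of the nonlinear program $$\max\ f(y)=\frac{\mathcal{A}y^m}{\mathcal{B}y^m}\,\|y\|^m\quad\text{subject to}\quad y\in\Sigma .$$
   Context: A real-valued $m$th-order $n$-dimensional tensor is an array $\mathcal{A}=(a_{i_1\cdots i_m})$ of real numbers with $i_1,\dots,i_m\in\{1,\dots,n\}$. It is symmetric if its entries are invariant under all permutations of the indices. For $x\in\mathbb{R}^n$: $\mathcal{A}x^m = \sum_{i_1,\dots,i_m} a_{i_1\cdots i_m}x_{i_1}\cdots x_{i_m}\in\mathbb{R}$, and $\mathcal{A}x^{m-1}\in\mathbb{R}^n$ has entries $(\mathcal{A}x^{m-1})_{i_1}=\sum_{i_2,\dots,i_m} a_{i_1\cdots i_m}x_{i_2}\cdots x_{i_m}$. A symmetric tensor $\mathcal{B}$ is positive definite if $\mathcal{B}x^m>0$ for all $x\in\mathbb{R}^n$, $x\neq 0$. $\|\cdot\|$ is the Euclidean norm and $\Sigma=\{y\in\mathbb{R}^n:\|y\|^m=1\}$ is the unit sphere. The constraint $y\in\Sigma$ is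 expressed as $\|y\|^m=1$, so the Lagrangian is $\mathcal{L}(y,\lambda)=f(y)-\lambda(\|y\|^m-1)$ (with $f$ defined on $\mathbb{R}^n\setminus\{0\}$); $y$ is a KKT point with Lagrange multiplier $\lambda$ if $y\in\Sigma$ and $\nabla_y\mathcal{L}(y,\lambda)=0$. *)

(* Defs.v *)
From HB Require Import structures.
From mathcomp Require Import all_boot all_order all_algebra all_fingroup.
From mathcomp Require Import all_classical all_reals all_analysis.

Set Implicit Arguments.
Unset Strict Implicit.
Unset Printing Implicit Defensive.

Import Order.TTheory GRing.Theory Num.Theory.
Import numFieldNormedType.Exports.

Local Open Scope classical_set_scope.
Local Open Scope ring_scope.

Definition tensor (R : realType) (m n : nat) := {ffun m.-tuple 'I_n -> R}.

Section Tensors.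
Context {R : realType} {m n : nat}.
Implicit Types (A : tensor R m n) (x : 'rV[R]_n).

Definition symmetric_tensor A : Prop :=
  forall (s : 'S_m) (I : m.-tuple 'I_n),
    A [tuple tnth I (s k) | k < m] = A I.

(* A x^m *)
Definition tensor_form A x : R :=
  \sum_(I : m.-tuple 'I_n) A I * \prod_(j <- I) x 0 j.

(* A x^(m-1): the first index is pinned to i and contributes no factor. For
   m = 0 no tuple has a first index, and the value is 0. *)
Definition tensor_app A x : 'rV[R]_n :=
  \row_i \sum_(I : m.-tuple 'I_n | ohead I == Some i)
    A I * \prod_(j <- behead I) x 0 j.

Definition posdef_tensor A : Prop := forall x, x != 0 -> 0 < tensor_form A x.

End Tensors.

Section Optimization.
Context {R : realType} {n : nat}.
Implicit Types (f : 'rV[R]_n -> R) (x y : 'rV[R]_n) (lambda : R).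

(* The norm `|x| that MathComp-Analysis puts on 'rV[R]_n is the sup norm; it
   defines the same topology, hence the same notion of differentiability. *)
Definition euclid_norm x : R := Num.sqrt (\sum_i x 0 i ^+ 2).

Definition unit_sphere (m : nat) : set 'rV[R]_n :=
  [set y | euclid_norm y ^+ m = 1].

Definition gradient f y : 'rV[R]_n := \row_i 'D_(delta_mx 0 i) f y.

Definition lagrangian (m : nat) f lambda y : R :=
  f y - lambda * (euclid_norm y ^+ m - 1).

(* Differentiability is required because 'D_v f y has an arbitrary value where
   the directional derivative does not exist. *)
Definition kkt_point (m : nat) f lambda y : Prop :=
  [/\ y \in unit_sphere m,
      differentiable (lagrangian m f lambda) y &
      gradient (lagrangian m f lambda) y = 0].

End Optimization.

(* Meaningful for y != 0 only: the value at 0 is a division by zero. *)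
Definition sphere_objective {R : realType} {m n : nat} (A B : tensor R m n)
    (y : 'rV[R]_n) : R :=
  tensor_form A y / tensor_form B y * euclid_norm y ^+ m.

(* Main.v *)
Require Import Defs.
From HB Require Import structures.
From mathcomp Require Import all_boot all_order all_algebra all_fingroup.
From mathcomp Require Import all_classical all_reals all_analysis.
From mathcomp Require Import ring.
Import Order.TTheory GRing.Theory Num.Theory.
Import numFieldNormedType.Exports.
Local Open Scope classical_set_scope.
Local Open Scope ring_scope.

(** Write q(y) = A y^m / B y^m.  The whole theorem is the formula, valid on the
unit sphere ([has_gradient_lagrangian]),

   grad L (y, lambda)
     = m ((A y^(m-1) - q(y) B y^(m-1)) / B y^m + (q(y) - lambda) y).

The quotient q is homogeneous of degree 0, so by Euler's identity its gradient,
the first summand, is orthogonal to y; the second summand is radial.  Hence the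
gradient vanishes iff both summands do, that is iff lambda = q(y) and
A y^(m-1) = q(y) B y^(m-1).  Conversely, pairing an eigenvector equation
A y^(m-1) = lambda B y^(m-1) with y gives lambda = q(y), so the two conditions
together are the eigenvector equation ([kkt_point_unit]).  Both sides of that
equation are homogeneous of degree m - 1 in y ([tensor_app_scale]), so it holds
at x iff it holds at x / |x|.

The formula rests on two gradients.  That of A y^m is m A y^(m-1): the product
rule gives m sums, one for each position of the differentiated factor, and the
symmetry of A makes them all equal ([has_gradient_tensor_form]).  Since m is
even, |y|^m is the polynomial (y_1^2 + ... + y_n^2)^(m/2), whose gradient on the
sphere is m y ([has_gradient_euclid_norm_even]). *)

(** * Gradient calculus *)

(** Differentiability is bundled with the value so that one application of each
rule below yields both requirements of [kkt_point]. *)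
Definition has_gradient {R : realType} {n : nat} (f : 'rV[R]_n -> R)
    (y g : 'rV[R]_n) : Prop :=
  differentiable f y /\ gradient f y = g.

Section GradientCalculus.
Context {R : realType} {n : nat}.
Implicit Types (f : 'rV[R]_n -> R) (y g : 'rV[R]_n).

(** Reduces each rule for gradients to the corresponding rules for
differentiability and for directional derivatives. *)
Lemma has_gradientP f y g :
  differentiable f y -> (forall i, is_derive y (delta_mx 0 i) f (g 0 i)) ->
  has_gradient f y g.
Proof.
by move=> df dg; split=> //; apply/rowP => i; rewrite mxE; have [] := dg i.
Qed.

Lemma has_gradient_is_derive f y g i :
  has_gradient f y g -> is_derive y (delta_mx 0 i) f (g 0 i).
Proof.
by move=> [df <-]; rewrite mxE; apply: DeriveDef => //; exact: diff_derivable.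
Qed.

Lemma has_gradient_eq f y g1 g2 :
  has_gradient f y g1 -> g1 = g2 -> has_gradient f y g2.
Proof. by move=> ? <-. Qed.

Lemma has_gradient_cst (c : R) y : has_gradient (cst c) y 0.
Proof.
apply: has_gradientP => [|i]; first exact: differentiable_cst.
by rewrite mxE; exact: is_derive_cst.
Qed.

Lemma has_gradientD f1 f2 y g1 g2 :
  has_gradient f1 y g1 -> has_gradient f2 y g2 ->
  has_gradient (fun z => f1 z + f2 z) y (g1 + g2).
Proof.
move=> h1 h2; apply: has_gradientP => [|i].
  by apply: differentiableD; [case: h1|case: h2].
by rewrite mxE; apply: is_deriveD; exact: has_gradient_is_derive.
Qed.

Lemma has_gradientM f1 f2 y g1 g2 :
  has_gradient f1 y g1 -> has_gradient f2 y g2 ->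
  has_gradient (fun z => f1 z * f2 z) y (f1 y *: g2 + f2 y *: g1).
Proof.
move=> h1 h2; apply: has_gradientP => [|i].
  by apply: differentiableM; [case: h1|case: h2].
rewrite !mxE; apply: is_deriveM; exact: has_gradient_is_derive.
Qed.

Lemma has_gradientZ (c : R) f y g :
  has_gradient f y g -> has_gradient (fun z => c * f z) y (c *: g).
Proof.
move=> h; apply: has_gradient_eq (has_gradientM _ _ _ _ _ (has_gradient_cst c y) h) _.
by rewrite scaler0 addr0.
Qed.

Lemma has_gradientV f y g : f y != 0 ->
  has_gradient f y g ->
  has_gradient (fun z => (f z)^-1) y (- (f y) ^- 2 *: g).
Proof.
move=> fy0 h; apply: has_gradientP => [|i].
  by apply: differentiableV => //; case: h.
have := has_gradient_is_derive _ _ _ i h => h'.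
rewrite mxE.
apply: DeriveDef; first by apply: derivableV.
by rewrite deriveV // derive_val.
Qed.

Lemma has_gradientX k f y g :
  has_gradient f y g ->
  has_gradient (fun z => f z ^+ k) y ((k%:R * f y ^+ k.-1) *: g).
Proof.
move=> h; elim: k => [|k IHk].
  by rewrite mul0r scale0r; exact: has_gradient_cst.
under eq_fun do rewrite exprS.
apply: has_gradient_eq (has_gradientM _ _ _ _ _ h IHk) _.
rewrite scalerA -scalerDl mulrCA; case: k {IHk} => [|k] /=.
  by rewrite mul0r add0r mul1r.
by rewrite -exprS -[X in _ + X]mul1r -mulrDl natr1.
Qed.

Lemma has_gradient_sum (I : Type) (r : seq I) (F : I -> 'rV[R]_n -> R)
    y (G : I -> 'rV[R]_n) :
  (forall i, has_gradient (F i) y (G i)) ->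
  has_gradient (fun z => \sum_(i <- r) F i z) y (\sum_(i <- r) G i).
Proof.
move=> h; elim: r => [|i r IHr].
  under eq_fun do rewrite big_nil.
  by rewrite big_nil; exact: has_gradient_cst.
under eq_fun do rewrite big_cons.
by rewrite big_cons; exact: has_gradientD.
Qed.

Lemma has_gradient_prod k (F : 'I_k -> 'rV[R]_n -> R) y (G : 'I_k -> 'rV[R]_n) :
  (forall i, has_gradient (F i) y (G i)) ->
  has_gradient (fun z => \prod_i F i z) y
    (\sum_i (\prod_(j | j != i) F j y) *: G i).
Proof.
elim: k F G => [|k IHk] F G h.
  under eq_fun do rewrite big_ord0.
  by rewrite big_ord0; exact: has_gradient_cst.
under eq_fun do rewrite big_ord_recl.
apply: has_gradient_eq.
  exact: has_gradientM (h ord0) (IHk _ _ (fun i => h (lift ord0 i))).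
rewrite big_ord_recl addrC; congr (_ *: _ + _).
  by rewrite [RHS]big_mkcond big_ord_recl /= mul1r.
rewrite scaler_sumr; apply: eq_bigr => i _; rewrite scalerA; congr (_ *: _).
rewrite [in RHS]big_mkcond big_ord_recl /= [in LHS]big_mkcond.
by congr (_ * _); apply: eq_bigr => j _; rewrite (inj_eq lift_inj).
Qed.

Lemma has_gradient_coord y j :
  has_gradient (fun z : 'rV[R]_n => z 0 j) y (delta_mx 0 j).
Proof.
split; first exact: differentiable_coord.
apply/rowP => i; rewrite mxE deriveE; last exact: differentiable_coord.
(* A coordinate is a continuous linear form, hence its own differential. *)
pose f (z : 'rV[R]_n) : R := z 0 j.
have lf : linear f by move=> c u v; rewrite /f !mxE.
pose fL : {linear 'rV[R]_n -> R} :=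
  HB.pack f (GRing.isLinear.Build _ _ _ _ f lf).
have -> : 'd (fun z : 'rV[R]_n => z 0 j) y = f :> ('rV[R]_n -> R).
  rewrite -[LHS]/('d fL y : _ -> _) diff_lin //; exact: coord_continuous.
by rewrite /f !mxE !eqxx /= eq_sym.
Qed.

End GradientCalculus.

(** * Symmetric tensors *)

Section TensorCalculus.
Context {R : realType} {n : nat}.
Implicit Types (x y : 'rV[R]_n).

Definition permute_tuple {m : nat} (s : 'S_m) (I : m.-tuple 'I_n) :
    m.-tuple 'I_n := [tuple tnth I (s k) | k < m].

Lemma permute_tuple_bij {m : nat} (s : 'S_m) : bijective (permute_tuple s).
Proof.
exists (permute_tuple s^-1%g) => I; apply: eq_from_tnth => k;
  by rewrite !tnth_mktuple ?permK ?permKV.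
Qed.

(** Summing over all tuples and letting the first index select the coordinate
puts [tensor_app] in the shape that the product rule produces. *)
Lemma tensor_appE {m : nat} (A : tensor R m.+1 n) y :
  tensor_app A y =
  \sum_I (A I * \prod_(k | k != ord0) y 0 (tnth I k)) *:
           delta_mx 0 (tnth I ord0).
Proof.
apply/rowP => i; rewrite mxE summxE big_mkcond; apply: eq_bigr => I _.
rewrite !mxE eqxx; case/tupleP: I => a I /=.
rewrite (inj_eq Some_inj) tnth0 eq_sym.
case: eqP => _; last by rewrite mulr0.
rewrite mulr1; congr (_ * _).
rewrite big_tuple [RHS]big_mkcond big_ord_recl /= mul1r.
by apply: eq_bigr => k _; rewrite tnthS.
Qed.

(** Pairing with [y] restores the missing factor of the pinned first index.
Together with [has_gradient_tensor_form] this is Euler's identity for the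
homogeneous polynomial A y^m. *)
Lemma tensor_form_app {m : nat} (A : tensor R m.+1 n) y :
  \sum_i y 0 i * tensor_app A y 0 i = tensor_form A y.
Proof.
rewrite /tensor_form tensor_appE.
under eq_bigr do rewrite summxE mulr_sumr.
rewrite exchange_big; apply: eq_bigr => I _ /=.
rewrite (bigD1 (tnth I ord0)) //= [X in _ + X]big1 ?addr0 => [|i /negPf neq].
  by rewrite !mxE !eqxx mulr1 mulrCA big_tuple [in RHS](bigD1 ord0).
by rewrite !mxE neq !mulr0.
Qed.

Lemma tensor_app_scale {m : nat} (A : tensor R m.+1 n) (c : R) y :
  tensor_app A (c *: y) = c ^+ m *: tensor_app A y.
Proof.
rewrite !tensor_appE scaler_sumr; apply: eq_bigr => I _.
rewrite scalerA mulrCA; congr (_ * _ *: _).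
under eq_bigr do rewrite mxE.
by rewrite big_split /= prodr_const cardC1 card_ord.
Qed.

(** Differentiating the factor at position k gives the sum defining
A y^(m-1) with index k pinned in place of the first one.  Exchanging positions
0 and k in the index tuples leaves the entries of a symmetric tensor unchanged,
so each of the m positions contributes the same vector A y^(m-1). *)
Lemma has_gradient_tensor_form {m : nat} (A : tensor R m.+1 n) y :
  symmetric_tensor A ->
  has_gradient (tensor_form A) y (m.+1%:R *: tensor_app A y).
Proof.
move=> symA.
have -> : tensor_form A = fun z => \sum_I A I * \prod_k z 0 (tnth I k).
  by apply/funext => z; apply: eq_bigr => I _; rewrite big_tuple.
apply: has_gradient_eq.
  apply: has_gradient_sum => I; apply: has_gradientZ.
  by apply: has_gradient_prod => k; exact: has_gradient_coord.
under eq_bigr do rewrite scaler_sumr.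
rewrite exchange_big /=; transitivity (\sum_(k < m.+1) tensor_app A y).
  2: by rewrite sumr_const card_ord scaler_nat.
apply: eq_bigr => k _.
(* The bijection I |-> I o (0 k) moves the pinned index from 0 to k. *)
rewrite tensor_appE (reindex _ (onW_bij _ (permute_tuple_bij (tperm ord0 k)))).
apply: eq_bigr => I _ /=; rewrite symA scalerA !tnth_mktuple tpermR.
congr (_ * _ *: _).
rewrite (reindex_inj (@perm_inj _ (tperm ord0 k))); apply: eq_big => j.
  by rewrite -{2}(tpermL ord0 k) (inj_eq perm_inj).
by rewrite tnth_mktuple tpermK.
Qed.

End TensorCalculus.

(** * Even powers of the Euclidean norm *)

Section EuclidNorm.
Context {R : realType} {n : nat}.
Implicit Types (x y : 'rV[R]_n).

Lemma euclid_norm_sqr x : euclid_norm x ^+ 2 = \sum_i x 0 i ^+ 2.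
Proof. by rewrite sqr_sqrtr // sumr_ge0 // => i _; exact: sqr_ge0. Qed.

Lemma euclid_norm_gt0 x : x != 0 -> 0 < euclid_norm x.
Proof.
move=> x0; rewrite sqrtr_gt0 lt_neqAle eq_sym sumr_ge0 => [|i _]; last exact: sqr_ge0.
rewrite andbT; apply: contra_neq x0 => s0; apply/rowP => i; apply/eqP.
rewrite mxE -sqrf_eq0; apply/eqP; move: i (erefl true).
by apply/psumr_eq0P => // i _; exact: sqr_ge0.
Qed.

Lemma euclid_norm_normalize x :
  x != 0 -> euclid_norm ((euclid_norm x)^-1 *: x) = 1.
Proof.
move=> /euclid_norm_gt0 N0; set c := (euclid_norm x)^-1; rewrite /euclid_norm.
under eq_bigr do rewrite mxE exprMn.
by rewrite -mulr_sumr -euclid_norm_sqr -exprMn mulVf ?gt_eqF // expr1n sqrtr1.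
Qed.

(** For even [m] the power is a polynomial in the squared norm, which avoids
differentiating the square root. *)
Lemma has_gradient_euclid_norm_even (m : nat) y :
  ~~ odd m -> euclid_norm y = 1 ->
  has_gradient (fun z => euclid_norm z ^+ m) y (m%:R *: y).
Proof.
move=> m_even y1.
have -> : (fun z : 'rV[R]_n => euclid_norm z ^+ m) =
          fun z => (\sum_i z 0 i ^+ 2) ^+ m./2.
  apply/funext => z.
  by rewrite -euclid_norm_sqr -exprM mul2n -[in LHS](even_halfK m_even).
apply: has_gradient_eq.
  apply: has_gradientX; apply: has_gradient_sum => i.
  by apply: has_gradientX; exact: has_gradient_coord.
rewrite /= -euclid_norm_sqr y1 !expr1n mulr1 [in RHS](row_sum_delta y) !scaler_sumr.
apply: eq_bigr => i _.
by rewrite !scalerA expr1 mulrA -natrM muln2 even_halfK.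
Qed.

End EuclidNorm.

(** * The Lagrangian on the sphere *)

(** The product and quotient rules.  On the sphere the factor |y|^m equals 1, so
it only contributes its radial gradient; the term -lambda comes from the
constraint. *)
Lemma has_gradient_lagrangian (R : realType) (m n : nat)
    (A B : tensor R m.+1 n) (lambda : R) (y : 'rV[R]_n) :
  ~~ odd m.+1 -> symmetric_tensor A -> symmetric_tensor B ->
  tensor_form B y != 0 -> euclid_norm y = 1 ->
  let q := tensor_form A y / tensor_form B y in
  has_gradient (lagrangian m.+1 (sphere_objective A B) lambda) y
    (m.+1%:R *: ((tensor_form B y)^-1 *: (tensor_app A y - q *: tensor_app B y)
                 + (q - lambda) *: y)).
Proof.
move=> m_even symA symB B0 y1 q.
have -> : lagrangian m.+1 (sphere_objective A B) lambda =
  fun z => tensor_form A z * (tensor_form B z)^-1 * euclid_norm z ^+ m.+1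
           + (- lambda * euclid_norm z ^+ m.+1 + lambda).
  by apply/funext => z; rewrite /lagrangian /sphere_objective; ring.
have hN := has_gradient_euclid_norm_even m.+1 y m_even y1.
apply: has_gradient_eq.
  apply: has_gradientD.
    apply: has_gradientM hN; apply: has_gradientM.
      exact: has_gradient_tensor_form.
    by apply: has_gradientV => //; exact: has_gradient_tensor_form.
  by apply: has_gradientD; [exact: has_gradientZ hN|exact: has_gradient_cst].
rewrite /= y1 expr1n; apply/rowP => i; rewrite !mxE /q.
by field.
Qed.

(** The gradient splits into a part orthogonal to [y] and a multiple of [y],
which therefore vanish separately. *)
Lemma kkt_point_unit (R : realType) (m n : nat)
    (A B : tensor R m.+1 n) (lambda : R) (y : 'rV[R]_n) :
  ~~ odd m.+1 -> symmetric_tensor A -> symmetric_tensor B ->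
  tensor_form B y != 0 -> euclid_norm y = 1 ->
  kkt_point m.+1 (sphere_objective A B) lambda y <->
  tensor_app A y = lambda *: tensor_app B y.
Proof.
move=> m_even symA symB B_neq0 y1; apply: iff_sym.
have [L_diff L_grad] :=
  has_gradient_lagrangian R m n A B lambda y m_even symA symB B_neq0 y1.
have mR_neq0 : m.+1%:R != 0 :> R by rewrite pnatr_eq0.
split=> [eig|[_ _ /eqP]].
  split=> //; first by rewrite inE /unit_sphere /= y1 expr1n.
  have q_eq : tensor_form A y / tensor_form B y = lambda.
    rewrite -tensor_form_app eig.
    under eq_bigr do rewrite mxE mulrCA.
    by rewrite -mulr_sumr tensor_form_app mulfK.
  by rewrite L_grad q_eq eig !subrr scale0r scaler0 addr0 scaler0.
rewrite L_grad scaler_eq0 (negPf mR_neq0) /= => /eqP grad0.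
set q := tensor_form A y / tensor_form B y in grad0.
(* The inner product with y kills the tangential part by Euler's identity. *)
have q_eq : q = lambda.
  have /(congr1 (fun g : 'rV[R]_n => \sum_i y 0 i * g 0 i)) := grad0.
  have -> : \sum_i y 0 i * (0 : 'rV[R]_n) 0 i = 0.
    by rewrite big1 // => i _; rewrite mxE mulr0.
  have -> : \sum_i y 0 i * ((tensor_form B y)^-1 *:
        (tensor_app A y - q *: tensor_app B y) + (q - lambda) *: y) 0 i =
      (tensor_form B y)^-1 * (tensor_form A y - q * tensor_form B y)
      + (q - lambda) * euclid_norm y ^+ 2.
    rewrite euclid_norm_sqr -!tensor_form_app !mulr_sumr -sumrB mulr_sumr -big_split /=.
    by apply: eq_bigr => i _; rewrite !mxE; ring.
  rewrite /q divfK // subrr mulr0 add0r y1 expr1n mulr1 => /eqP.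
  by rewrite subr_eq0 => /eqP.
move: grad0; rewrite q_eq subrr scale0r addr0 => /eqP.
by rewrite scaler_eq0 invr_eq0 (negPf B_neq0) subr_eq0 => /eqP.
Qed.

(** * Generalized eigenvectors and KKT points *)

Theorem theorem3p2 (R : realType) (m n : nat)
    (m_ge2 : (2 <= m)%N) (m_even : ~~ odd m) (n_ge1 : (1 <= n)%N)
    (A B : tensor R m n)
    (A_sym : symmetric_tensor A)
    (B_sym : symmetric_tensor B) (B_posdef : posdef_tensor B)
    (lambda : R) (x : 'rV[R]_n) (x_neq0 : x != 0) :
  tensor_app A x = lambda *: tensor_app B x <->
  kkt_point m (sphere_objective A B) lambda ((euclid_norm x)^-1 *: x).
Proof.
case: m m_ge2 m_even A B A_sym B_sym B_posdef => // m _ m_even A B.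
move=> A_sym B_sym B_posdef.
have c_gt0 : 0 < (euclid_norm x)^-1 by rewrite invr_gt0 euclid_norm_gt0.
have y1 := euclid_norm_normalize x x_neq0.
have B_neq0 : tensor_form B ((euclid_norm x)^-1 *: x) != 0.
  by rewrite gt_eqF // B_posdef // scaler_eq0 negb_or gt_eqF.
apply: iff_trans (iff_sym
  (kkt_point_unit R m n A B lambda _ m_even A_sym B_sym B_neq0 y1)).
rewrite !tensor_app_scale scalerA mulrC -scalerA.
by split=> [->//|]; apply: scalerI; rewrite expf_neq0 // gt_eqF.
Qed.
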